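(* Let $\mathcal{O}$ be an order of an algebraic number field and let $n\ge 2$ be an integer. Then every matrix in $M_n(\mathcal{O})$ is a sum of eighth powers of matrices in $M_n(\mathcal{O})$ if and only if $\gcd(2,\operatorname{disc}\mathcal{O})=1$.
   Context: An order of an algebraic number field $K$ of degree $m$ is a subring of $K$ containing $1$ which is a free $\mathbb{Z}$-module of rank $m$. $\operatorname{disc}\mathcal{O}$ is the discriminant of $\mathcal{O}$. A matrix $M$ is a sum of eighth powers in $M_n(\mathcal{O})$ if $M=\sum_{i=1}^r M_i^8$ for some $r\ge1$ and $M_i\in M_n(\mathcal{O})$. *)

(* Defs.v *)
From HB Require Import structures.
From mathcomp Require Import all_boot all_order all_algebra all_field.
From mathcomp Require Import boolp.

Set Implicit Arguments.
Unset Strict Implicit.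
Unset Printing Implicit Defensive.

Import GRing.Theory Num.Theory.
Local Open Scope ring_scope.

Definition Zbasis (K : fieldExtType rat) (S : {pred K}) (m : nat)
    (b : m.-tuple K) : Prop :=
  (forall x : K, x \in S <-> inIntSpan b x) /\
  (forall c : 'I_m -> int, \sum_(i < m) b`_i *~ c i = 0 -> forall i, c i = 0).

Record nf_order (K : fieldExtType rat) := NfOrder {
  nf_order_pred :> subringClosed K;
  nf_order_free : exists b : (\dim {:K}).-tuple K, Zbasis nf_order_pred b
}.

(* The trace of K over Q: the trace of multiplication by x. *)
Definition nf_trace (K : fieldExtType rat) (x : K) : rat :=
  \tr (passmx.mxof (vbasis {:K}) (vbasis {:K}) (amull x)).

Definition disc_tuple (K : fieldExtType rat) (m : nat) (b : m.-tuple K) : rat :=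
  \det (\matrix_(i < m, j < m) nf_trace (b`_i * b`_j)).

Definition nf_order_basis (K : fieldExtType rat) (O : nf_order K) :
  (\dim {:K}).-tuple K := sval (cid (nf_order_free O)).

(* The determinant is an integer, and the chosen Z-basis is immaterial: see
   [discE]. *)
Definition disc (K : fieldExtType rat) (O : nf_order K) : int :=
  numq (disc_tuple (nf_order_basis O)).

Definition sum_of_powers (R : pzRingType) (n k : nat) (S : {pred R})
    (M : 'M[R]_n) : Prop :=
  exists (r : nat) (Ms : 'I_r -> 'M[R]_n),
    [/\ (0 < r)%N, forall i, Ms i \is a mxOver S & M = \sum_(i < r) Ms i ^+ k].

Section DiscTheory.

Variables (K : fieldExtType rat) (O : nf_order K).
Local Notation m := (\dim {:K}).
Implicit Types (b : m.-tuple K) (x : K).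

Lemma Zbasis_basis b : Zbasis O b -> basis_of {:K} b.
Proof.
case=> _ Ofree; rewrite basisEfree subvf size_tuple leqnn !andbT.
apply/freeP => k sum0 i; pose d : int := \prod_(j < m) denq (k j).
have d_neq0 : d%:~R != 0 :> rat.
  by rewrite intr_eq0; apply/prodf_neq0 => j _; apply: denq_neq0.
have dk_int j : d%:~R * k j \is a Num.int.
  rewrite /d (bigD1 j) //= intrM mulrAC [_ * k j]mulrC -numqE.
  by rewrite rpredM ?intr_int.
have cE j : (numq (d%:~R * k j))%:~R = d%:~R * k j by apply: numqK.
have csum0 : \sum_(j < m) b`_j *~ numq (d%:~R * k j) = 0.
  transitivity (d%:~R *: (\sum_(j < m) k j *: b`_j)); last first.
    by rewrite sum0 scaler0.
  rewrite scaler_sumr; apply: eq_bigr => j _.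
  by rewrite scalerA -[X in _ = X *: _]cE scaler_int.
have: (numq (d%:~R * k i))%:~R = 0 :> rat by rewrite (Ofree _ csum0).
by rewrite cE => /eqP; rewrite mulf_eq0 (negPf d_neq0) => /eqP.
Qed.

Lemma Zbasis_mem b (i : 'I_m) : Zbasis O b -> b`_i \in O.
Proof.
case=> Ospan _; apply/Ospan; exists [ffun j => (j == i)%:R].
rewrite (bigD1 i) //= ffunE eqxx big1 ?addr0 // => j /negPf ji.
by rewrite ffunE ji mulr0z.
Qed.

Lemma coord_Zbasis_int b x (i : 'I_m) :
  Zbasis O b -> x \in O -> coord b i x \is a Num.int.
Proof.
move=> bO; have /basis_free bfree := Zbasis_basis bO.
case: (bO) => Ospan _ /Ospan[a ->].
under eq_bigr do rewrite -scaler_int.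
by rewrite coord_sum_free // intr_int.
Qed.

Lemma det_int n (A : 'M[rat]_n) :
  (forall i j, A i j \is a Num.int) -> \det A \is a Num.int.
Proof.
move=> Aint; apply: rpred_sum => s _; rewrite rpredM ?rpred_sign //.
by apply: rpred_prod => i _; apply: Aint.
Qed.

Lemma nf_traceE b x :
  basis_of {:K} b -> nf_trace x = \tr (passmx.mxof b b (amull x)).
Proof.
move=> bB; have eB := vbasisP {:K}; rewrite /nf_trace.
rewrite -[X in passmx.mxof (vbasis _) _ X]comp_lfun1r (passmx.mxof_comp _ _ bB).
rewrite -[X in _ *m passmx.mxof _ _ X]comp_lfun1l (passmx.mxof_comp _ _ bB).
rewrite mulmxA mxtrace_mulC mulmxA -(passmx.mxof_comp _ _ eB) !comp_lfun1l.
by rewrite passmx.mxof1 ?mul1mx // (basis_free bB).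
Qed.

Lemma nf_traceP (a : rat) x y :
  nf_trace (a *: x + y) = a * nf_trace x + nf_trace y.
Proof.
by rewrite /nf_trace linearP passmx.mxof_linear mxtraceD mxtraceZ.
Qed.

Lemma nf_trace0 : nf_trace (0 : K) = 0.
Proof. by rewrite -{1}[0](addNr 0) -scaleN1r nf_traceP mulN1r addNr. Qed.

Lemma nf_traceZ (a : rat) x : nf_trace (a *: x) = a * nf_trace x.
Proof. by rewrite -[a *: x]addr0 nf_traceP nf_trace0 addr0. Qed.

Lemma nf_trace_sum (F : 'I_m -> K) :
  nf_trace (\sum_i F i) = \sum_i nf_trace (F i).
Proof.
apply: (big_morph _ _ nf_trace0) => x y.
by rewrite -[x in LHS]scale1r nf_traceP mul1r.
Qed.

Lemma nf_trace_int x : x \in O -> nf_trace x \is a Num.int.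
Proof.
move=> Ox; have [b bO] := nf_order_free O.
rewrite (nf_traceE _ (Zbasis_basis bO)); apply: rpred_sum => i _.
rewrite !mxE /= passmx.vecof_delta lfunE /=.
by rewrite coord_Zbasis_int ?rpredM ?Zbasis_mem.
Qed.

Lemma disc_tuple_int b : Zbasis O b -> disc_tuple b \is a Num.int.
Proof.
by move=> bO; apply: det_int => i j; rewrite mxE nf_trace_int ?rpredM ?Zbasis_mem.
Qed.

Lemma disc_tuple_change b b' : basis_of {:K} b ->
  disc_tuple b' = \det (passmx.mxof b' b \1%VF) ^+ 2 * disc_tuple b.
Proof.
move=> bB; set P := passmx.mxof b' b \1%VF.
have PE (i : 'I_m) : b'`_i = \sum_j P i j *: b`_j.
  rewrite [LHS](coord_basis bB) ?memvf //; apply: eq_bigr => j _.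
  by rewrite !mxE /= passmx.vecof_delta lfunE.
move: P PE => P PE; have -> : disc_tuple b' =
    \det (P *m (\matrix_(i < m, j < m) nf_trace (b`_i * b`_j)) *m P^T).
  congr (\det _); apply/matrixP => i j; rewrite !mxE !PE mulr_sumr nf_trace_sum.
  apply: eq_bigr => k _; rewrite !mxE -scalerAr nf_traceZ mulrC.
  congr (_ * _); rewrite mulr_suml nf_trace_sum; apply: eq_bigr => l _.
  by rewrite mxE -scalerAl nf_traceZ.
by rewrite !det_mulmx det_tr mulrAC expr2.
Qed.

Lemma disc_tuple_Zbasis b b' :
  Zbasis O b -> Zbasis O b' -> disc_tuple b' = disc_tuple b.
Proof.
move=> bO b'O; have bB := Zbasis_basis bO; have b'B := Zbasis_basis b'O.
have det_i b1 b2 : Zbasis O b1 -> Zbasis O b2 ->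
    \det (passmx.mxof b1 b2 \1%VF) \is a Num.int.
  move=> b1O b2O; apply: det_int => i j; rewrite !mxE /= passmx.vecof_delta.
  by rewrite lfunE; apply: coord_Zbasis_int (Zbasis_mem _ _).
have PQ1 : \det (passmx.mxof b' b \1%VF) * \det (passmx.mxof b b' \1%VF) = 1.
  rewrite -det_mulmx -(passmx.mxof_comp _ _ bB) comp_lfun1l passmx.mxof1 ?det1 //.
  exact: basis_free b'B.
rewrite (disc_tuple_change b' bB).
have /intrP[p pE] := det_i _ _ b'O bO; have /intrP[q qE] := det_i _ _ bO b'O.
move: PQ1; rewrite pE qE -intrM => /(@intr_inj rat _ 1); rewrite mulrC => pq1.
have /orP[] : (p == 1) || (p == -1) by apply: (intUnitRing.unitzPl pq1).
  by move/eqP->; rewrite expr1n mul1r.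
by move/eqP->; rewrite intrN sqrrN expr1n mul1r.
Qed.

Lemma discE b : Zbasis O b -> (disc O)%:~R = disc_tuple b.
Proof.
move=> bO; have b0O : Zbasis O (nf_order_basis O) := svalP (cid _).
by rewrite /disc numqK ?disc_tuple_int //; apply: disc_tuple_Zbasis.
Qed.

End DiscTheory.

(* Main.v *)
(** Both conditions are equivalent to surjectivity of the Frobenius
    [x |-> x^2] on [O/2O].

    If all matrices are sums of eighth powers, so is [x E_11], and since
    [tr(N^2) = tr(N)^2] mod [2], its trace [x] is a sum of squares mod [2],
    hence a square.  Conversely, idempotents and matrices of order 3 are eighth
    powers, and their sums give all 2x2 matrices of trace zero; it remains to
    show that every [x] in [O] is the trace of a sum of eighth powers.  Such
    traces include [t^8 - 8 t^6 d + 20 t^4 d^2 - 16 t^2 d^3 + 2 d^4], for all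
    [t, d] in [O].  They form a group, because [t^8] and [-t^8] (for [d = 0] and
    [d = t^2]) already generate [8! O] up to integers.  This group contains
    [16 O], and then [8 O], [4 O], [2 O] and [O] in turn because the Frobenius
    is surjective.

    An element of [O/2O] of square zero is in the radical of the trace form, so
    if the discriminant is odd, the Frobenius is injective.  Conversely, if it
    is bijective then [x^(2^k) = x] on [O/2O] for some [k > 0], so that [O/2O]
    is simultaneously diagonalizable over the field with [2^k] elements, and
    the trace form is [D D^T] with [D] invertible. *)

Require Import Defs.
From mathcomp Require Import all_boot all_order all_fingroup all_algebra.
From mathcomp Require Import all_field.
From mathcomp Require Import ring.

Set Implicit Arguments.
Unset Strict Implicit.
Unset Printing Implicit Defensive.

Import GRing.Theory Num.Theory.
Local Open Scope ring_scope.

(** Surjectivity of the Frobenius on [S/2S], stated by representatives instead of in the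
    quotient. *)
Definition square_mod2 (R : pzRingType) (S : {pred R}) : Prop :=
  forall x, x \in S -> exists y z, [/\ y \in S, z \in S & x = y ^+ 2 + z *+ 2].

(** * Closure properties of sums of powers *)

Section SumOfPowers.
Variables (R : comNzRingType) (S : subringClosed R).

Lemma sum_of_powersX n k (A : 'M[R]_n) :
  A \is a mxOver S -> sum_of_powers k S (A ^+ k).
Proof. by move=> AS; exists 1, (fun=> A); split=> //; rewrite big_ord1. Qed.

Lemma sum_of_powersD n k (A B : 'M[R]_n) :
  sum_of_powers k S A -> sum_of_powers k S B -> sum_of_powers k S (A + B).
Proof.
move=> [r [As [r0 AS ->]]] [s [Bs [s0 BS ->]]].
exists (r + s), (fun i => match split i with inl j => As j | inr j => Bs j end).
split; first by rewrite addn_gt0 r0.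
  by move=> i; case: split.
rewrite big_split_ord; congr (_ + _); apply: eq_bigr => i _.
  by rewrite -[lshift _ i]/(unsplit (inl i)) unsplitK.
by rewrite -[rshift _ i]/(unsplit (inr i)) unsplitK.
Qed.

Lemma sum_of_powers0 n k : (0 < k)%N -> sum_of_powers k S (0 : 'M[R]_n).
Proof.
case: k => // k _; have <- : (0 : 'M[R]_n) ^+ k.+1 = 0 by rewrite exprS mul0r.
by apply: sum_of_powersX; apply: mxOver0; apply: rpred0.
Qed.

Lemma sum_of_powers_sum n k (I : Type) (r : seq I) (P : pred I)
    (F : I -> 'M[R]_n) : (0 < k)%N ->
  (forall i, P i -> sum_of_powers k S (F i)) ->
  sum_of_powers k S (\sum_(i <- r | P i) F i).
Proof.
move=> k0 FS; apply: big_ind => //; first exact: sum_of_powers0.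
by move=> A B; apply: sum_of_powersD.
Qed.

(** As [P *m P^T = 1], the map [A |-> P^T *m A *m P] is multiplicative; it need not preserve 1,
    whence [0 < k]. *)
Lemma sum_of_powers_embed n p k (P : 'M[R]_(p, n)) (A : 'M[R]_p) :
  (0 < k)%N -> P *m P^T = 1%:M -> P \is a mxOver S ->
  sum_of_powers k S A -> sum_of_powers k S (P^T *m A *m P).
Proof.
move=> k0 PP PS [r [As [r0 AS ->]]].
have PTS : P^T \is a mxOver S by apply/mxOverP=> i j; rewrite mxE (mxOverP PS).
exists r, (fun i => P^T *m As i *m P); split=> // [i|].
  by rewrite !mxOverM.
rewrite mulmx_sumr mulmx_suml; apply: eq_bigr => i _.
case: k k0 => // k _; elim: k => [|k IHk]; first by rewrite !expr1.
rewrite [in RHS]exprS -IHk [in LHS]exprS.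
by rewrite -!mulmxE !mulmxA -(mulmxA _ P) PP mulmx1.
Qed.

End SumOfPowers.

(** * Eighth powers of 2 by 2 matrices *)

Section TwoByTwo.
Variables (R : comNzRingType) (S : subringClosed R).

Definition mx22 (a b c d : R) : 'M[R]_2 :=
  \matrix_(i, j) if i == 0 then if j == 0 then a else b
                 else if j == 0 then c else d.


Lemma mx22E (A : 'M[R]_2) : A = mx22 (A 0 0) (A 0 1) (A 1 0) (A 1 1).
Proof.
apply/matrixP=> -[[|[|//]] i2] -[[|[|//]] j2]; rewrite mxE /=;
  by congr (A _ _); apply: val_inj.
Qed.

Lemma mulmx22 a b c d a' b' c' d' :
  mx22 a b c d *m mx22 a' b' c' d' =
  mx22 (a * a' + b * c') (a * b' + b * d') (c * a' + d * c') (c * b' + d * d').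
Proof.
apply/matrixP=> i j; rewrite !mxE !big_ord_recl big_ord0 !mxE /= addr0.
by case: ifP; case: ifP.
Qed.

Lemma addmx22 a b c d a' b' c' d' :
  mx22 a b c d + mx22 a' b' c' d' = mx22 (a + a') (b + b') (c + c') (d + d').
Proof. by apply/matrixP=> i j; rewrite !mxE; case: ifP; case: ifP. Qed.

Lemma mx22_over a b c d :
  a \in S -> b \in S -> c \in S -> d \in S -> mx22 a b c d \is a mxOver S.
Proof. by move=> *; apply/mxOverP=> i j; rewrite mxE; case: ifP; case: ifP. Qed.

Lemma mx22_exp8 (A : 'M[R]_2) : A ^+ 8 =
  (A *m A *m (A *m A)) *m (A *m A *m (A *m A)).
Proof. by rewrite (exprM A 2 4) (exprM _ 2 2) !expr2. Qed.

Local Notation sum8 a b c d := (sum_of_powers 8 S (mx22 a b c d)).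

Lemma sum8_idem a b c d : a * a + b * c = a -> a * b + b * d = b ->
  c * a + d * c = c -> c * b + d * d = d ->
  a \in S -> b \in S -> c \in S -> d \in S -> sum8 a b c d.
Proof.
move=> ea eb ec ed aS bS cS dS.
have idem : mx22 a b c d *m mx22 a b c d = mx22 a b c d.
  by rewrite mulmx22 ea eb ec ed.
have <- : mx22 a b c d ^+ 8 = mx22 a b c d by rewrite mx22_exp8 !idem.
exact/sum_of_powersX/mx22_over.
Qed.

Lemma sum8_opp1 : sum8 (-1) 0 0 (-1).
Proof.
(* A matrix [W] of trace -1 and determinant 1 satisfies [W^2 + W + 1 = 0], so [W^3 = 1]; then
   [W^2 = W^8] and [W = (W^2)^8] are eighth powers with sum -1. *)
have W b c : b * c = -1 -> b \in S -> c \in S ->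
    sum8 0 b c (-1) /\ sum8 (-1) (- b) (- c) 0.
  move=> bc bS cS.
  have WS : mx22 0 b c (-1) \is a mxOver S.
    by rewrite mx22_over ?rpred0 ?rpredN ?rpred1.
  have W2S : mx22 (-1) (- b) (- c) 0 \is a mxOver S.
    by rewrite mx22_over ?rpredN ?rpred0 ?rpred1.
  have W2 : mx22 0 b c (-1) *m mx22 0 b c (-1) = mx22 (-1) (- b) (- c) 0.
    by rewrite mulmx22 [c * b]mulrC bc; congr mx22; ring.
  have W4 : mx22 (-1) (- b) (- c) 0 *m mx22 (-1) (- b) (- c) 0 =
      mx22 0 b c (-1).
    by rewrite mulmx22 !mulrNN [c * b]mulrC bc; congr mx22; ring.
  split.
    by have := sum_of_powersX 8 W2S; rewrite mx22_exp8 W4 W2 W4.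
  by have := sum_of_powersX 8 WS; rewrite mx22_exp8 W2 W4 W2.
have [] := W 1 (-1); rewrite ?mul1r ?rpredN ?rpred1 // => /sum_of_powersD H /H.
by rewrite addmx22 !subrr addr0 add0r.
Qed.

(** Add [E_22] and [-1] to the idempotent with rows [(1, b)] and [(0, 0)]. *)
Lemma sum8_upper b : b \in S -> sum8 0 b 0 0.
Proof.
move=> bS; have E1 : sum8 1 b 0 0.
  by apply: sum8_idem; rewrite ?rpred0 ?rpred1 //; ring.
have E2 : sum8 0 0 0 1.
  by apply: sum8_idem; rewrite ?rpred0 ?rpred1 //; ring.
have := sum_of_powersD (sum_of_powersD E1 E2) sum8_opp1.
by rewrite !addmx22 !(add0r, addr0) subrr.
Qed.

Lemma sum8_lower c : c \in S -> sum8 0 0 c 0.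
Proof.
move=> cS; have E1 : sum8 1 0 c 0.
  by apply: sum8_idem; rewrite ?rpred0 ?rpred1 //; ring.
have E2 : sum8 0 0 0 1.
  by apply: sum8_idem; rewrite ?rpred0 ?rpred1 //; ring.
have := sum_of_powersD (sum_of_powersD E1 E2) sum8_opp1.
by rewrite !addmx22 !(add0r, addr0) subrr.
Qed.

Lemma sum8_diag x : x \in S -> sum8 x 0 0 (- x).
Proof.
move=> xS; have x1S : 1 - x \in S by rewrite rpredB ?rpred1.
(* Idempotent by Cayley-Hamilton: trace 1 and determinant 0. Cancelling the off-diagonal entries and
   adding [E_11 - 1] leaves the diagonal [x, -x]. *)
have E : sum8 x (x * (1 - x)) 1 (1 - x).
  by apply: sum8_idem; rewrite ?rpredM ?rpred1 //; ring.
have U : sum8 0 (- (x * (1 - x))) 0 0.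
  by apply: sum8_upper; rewrite rpredN rpredM.
have L : sum8 0 0 (-1) 0 by apply: sum8_lower; rewrite rpredN rpred1.
have E1 : sum8 1 0 0 0.
  by apply: sum8_idem; rewrite ?rpred0 ?rpred1 //; ring.
have -> : mx22 x 0 0 (- x) = mx22 x (x * (1 - x)) 1 (1 - x) +
    mx22 0 (- (x * (1 - x))) 0 0 + (mx22 0 0 (-1) 0 +
    (mx22 1 0 0 0 + mx22 (-1) 0 0 (-1))).
  by rewrite !addmx22; congr mx22; ring.
by do !apply: sum_of_powersD => //; apply: sum8_opp1.
Qed.

(** Matrices of equal trace differ by a strictly upper, a strictly lower and a traceless diagonal
    matrix, so only the trace matters. *)
Lemma sum8_trace a b c d a' b' c' d' : a + d = a' + d' ->
  a \in S -> b \in S -> c \in S -> d \in S ->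
  a' \in S -> b' \in S -> c' \in S -> d' \in S ->
  sum8 a b c d -> sum8 a' b' c' d'.
Proof.
move=> tr *; have -> : mx22 a' b' c' d' = mx22 a b c d +
    (mx22 0 (b' - b) 0 0 +
    (mx22 0 0 (c' - c) 0 + mx22 (a' - a) 0 0 (- (a' - a)))).
  rewrite !addmx22; congr mx22; try ring.
  by apply: (addrI a'); rewrite -tr; ring.
do 3?[apply: sum_of_powersD] => //.
- by apply: sum8_upper; rewrite rpredB.
- by apply: sum8_lower; rewrite rpredB.
by apply: sum8_diag; rewrite rpredB.
Qed.

(** * Traces of sums of eighth powers *)

Definition trace8 x := sum8 x 0 0 0.

(* The trace of the eighth power of a matrix of trace [t] and determinant [d]. *)
Definition tr8 (t d : R) : R :=
  t ^+ 8 - 8%:R * t ^+ 6 * d + 20%:R * t ^+ 4 * d ^+ 2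
  - 16%:R * t ^+ 2 * d ^+ 3 + 2%:R * d ^+ 4.

Lemma trace8_tr8 t d : t \in S -> d \in S -> trace8 (tr8 t d).
Proof.
move=> tS dS.
(* The companion matrix of [X^2 - t X + d]. *)
have AS : mx22 t (- d) 1 0 \is a mxOver S.
  by rewrite mx22_over ?rpredN ?rpred0 ?rpred1.
have := sum_of_powersX 8 AS.
have {AS} : mx22 t (- d) 1 0 ^+ 8 \is a mxOver S.
  by rewrite mx22_exp8 !mxOverM.
rewrite mx22_exp8 !mulmx22.
set a := (X in mx22 X _ _ _); set b := (X in mx22 _ X _ _).
set c := (X in mx22 _ _ X _); set e := (X in mx22 _ _ _ X).
move=> /mxOverP AS AX; apply: sum8_trace AX => //.
- by rewrite /a /e /tr8; ring.
- by have := AS 0 0; rewrite mxE.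
- by have := AS 0 1; rewrite mxE.
- by have := AS 1 0; rewrite mxE.
- by have := AS 1 1; rewrite mxE.
- by rewrite /tr8 !(rpredD, rpredN, rpredM, rpredX, rpred1, tS, dS).
all: apply: rpred0.
Qed.

Let trace8D x y : trace8 x -> trace8 y -> trace8 (x + y).
Proof.
by move=> Tx Ty; have := sum_of_powersD Tx Ty; rewrite addmx22 !addr0.
Qed.

Let trace8Mn x k : trace8 x -> trace8 (x *+ k).
Proof.
move=> Tx; elim: k => [|k IHk]; last by rewrite mulrS; apply: trace8D.
by have := trace8_tr8 (rpred0 S) (rpred0 S); congr trace8; rewrite /tr8; ring.
Qed.

(** For [d = t^2] the eigenvalues are [t] times the primitive sixth roots of unity, whose eighth
    powers sum to -1. *)
Let trace8X t : t \in S -> trace8 (t ^+ 8) /\ trace8 (- t ^+ 8).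
Proof.
move=> tS; split.
  by have := trace8_tr8 tS (rpred0 S); congr trace8; rewrite /tr8; ring.
by have := trace8_tr8 tS (rpredX 2 tS); congr trace8; rewrite /tr8; ring.
Qed.

(* The seventh finite difference of [x ^ 8] is [8! x] plus an integer. *)
Let trace8_opp_multiple x : x \in S -> exists n, trace8 (- x *+ n.+1).
Proof.
move=> xS; exists (8`!).-1; rewrite prednK ?fact_gt0 // !factS fact0 !mulrnA.
have shiftS k : x + k%:R \in S by rewrite rpredD ?rpred_nat.
have pos j k : trace8 ((x + k%:R) ^+ 8 *+ j) by apply/trace8Mn/(trace8X _).1.
have neg j k : trace8 (- (x + k%:R) ^+ 8 *+ j) by apply/trace8Mn/(trace8X _).2.
(* The integer in the finite difference is [8! * 7/2 = 141120], here factored as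
   [8 * 9 * 7 * 5 * 7 * 8]. *)
have one := trace8Mn 8 (trace8Mn 9 (trace8Mn 7 (trace8Mn 5 (trace8Mn 7
  (trace8Mn 8 (trace8X (rpred1 S)).1))))).
have := trace8D (trace8D (trace8D (neg 1 7) (pos 7 6))
  (trace8D (neg 21 5) (pos 35 4))) (trace8D (trace8D (neg 35 3) (pos 21 2))
  (trace8D (neg 7 1) (pos 1 0))).
by move=> /trace8D /(_ one); congr trace8; ring.
Qed.

(** Since [-x = -(n + 1) x + n x], one negative multiple suffices. *)
Let trace8N x : x \in S -> trace8 x -> trace8 (- x).
Proof.
move=> xS Tx; have [n Tn] := trace8_opp_multiple xS.
by have := trace8D Tn (trace8Mn n Tx); rewrite mulrS mulNrn subrK.
Qed.

Definition sum8_trace_group x := x \in S /\ trace8 x.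

Local Notation G := sum8_trace_group.

Let GD x y : G x -> G y -> G (x + y).
Proof. by move=> [xS Tx] [yS Ty]; split; [apply: rpredD | apply: trace8D]. Qed.

Let GN x : G x -> G (- x).
Proof. by move=> [xS Tx]; split; [rewrite rpredN | apply: trace8N]. Qed.

Let GMn x k : G x -> G (x *+ k).
Proof. by move=> [xS Tx]; split; [apply: rpredMn | apply: trace8Mn]. Qed.

Let G_tr8 t d : t \in S -> d \in S -> G (tr8 t d).
Proof.
move=> tS dS; split; last exact: trace8_tr8.
by rewrite /tr8 !(rpredD, rpredN, rpredM, rpredX, rpred1, tS, dS).
Qed.

Let G_double_X4 d : d \in S -> G (d ^+ 4 *+ 2).
Proof.
by move=> dS; have := G_tr8 (rpred0 S) dS; congr G; rewrite /tr8; ring.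
Qed.

Let GX8 t : t \in S -> G (t ^+ 8).
Proof.
by move=> tS; have := G_tr8 tS (rpred0 S); congr G; rewrite /tr8; ring.
Qed.

Let G_cubic d : d \in S -> G (- d *+ 8 + d ^+ 2 *+ 20 - d ^+ 3 *+ 16).
Proof.
move=> dS; have := GD (G_tr8 (rpred1 S) dS) (GN (G_double_X4 dS)).
by move=> /GD /(_ (GN (GX8 (rpred1 S)))); congr G; rewrite /tr8; ring.
Qed.

(* The polarization of 2 d^4 at (a, 1). *)
Let G_polar a : a \in S -> G (a *+ 8 + a ^+ 2 *+ 12 + a ^+ 3 *+ 8).
Proof.
move=> aS; have := G_double_X4 (rpredD aS (rpred1 S)).
move=> /GD /(_ (GN (GD (G_double_X4 aS) (G_double_X4 (rpred1 S))))).
by congr G; ring.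
Qed.

(** Adding values at [a] and [-a] leaves the even parts: [24 a^2] from [G_polar], [40 a^2] from
    [G_cubic], and [2 * 24 - 40 = 8]. *)
Let G_8sqr a : a \in S -> G (a ^+ 2 *+ 8).
Proof.
move=> aS; have NaS : - a \in S by rewrite rpredN.
have := GD (GMn 2 (GD (G_polar aS) (G_polar NaS)))
  (GN (GD (G_cubic aS) (G_cubic NaS))).
by congr G; ring.
Qed.

(** Polarization of [8 a^2] at [(a, 1)]. *)
Let G_16 a : a \in S -> G (a *+ 16).
Proof.
move=> aS; have := GD (G_8sqr (rpredD aS (rpred1 S)))
  (GN (GD (G_8sqr aS) (G_8sqr (rpred1 S)))).
by congr G; ring.
Qed.

Hypothesis Ssqr : square_mod2 S.

Let G_8 a : a \in S -> G (a *+ 8).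
Proof.
move=> /Ssqr[y [z [yS zS ->]]].
by have := GD (G_8sqr yS) (G_16 zS); congr G; ring.
Qed.

(** Modulo [8 S], already in [G], the cubic at [y] is [4 y^2], that is [4 a]. *)
Let G_4 a : a \in S -> G (a *+ 4).
Proof.
move=> /Ssqr[y [z [yS zS ->]]].
have wS : z + y - y ^+ 2 *+ 2 + y ^+ 3 *+ 2 \in S.
  by rewrite !(rpredD, rpredN, rpredMn, rpredX).
by have := GD (G_cubic yS) (G_8 wS); congr G; ring.
Qed.

(** Two successive square roots give [a = w^4] modulo 2, so [2 a = 2 w^4] modulo [4 S]. *)
Let G_2 a : a \in S -> G (a *+ 2).
Proof.
move=> /Ssqr[y [z [/Ssqr[w [v [wS vS ->]]] zS ->]]].
have rS : w ^+ 2 * v *+ 2 + v ^+ 2 *+ 2 + z \in S.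
  by rewrite !(rpredD, rpredM, rpredMn, rpredX).
by have := GD (G_double_X4 wS) (G_4 rS); congr G; ring.
Qed.

Lemma trace8_all a : a \in S -> trace8 a.
Proof.
move=> aS; suff [] : G a by [].
move: aS => /Ssqr[y [z [/Ssqr[w [v [/Ssqr[u [s [uS sS ->]]] vS ->]]] zS ->]]].
pose W := u ^+ 2 + s *+ 2.
(* Half of [a - u^8], expanded: three successive square roots make [a] congruent to [u^8] modulo
   2. *)
have rS : u ^+ 6 * s *+ 4 + u ^+ 4 * s ^+ 2 *+ 12 + u ^+ 2 * s ^+ 3 *+ 16
    + s ^+ 4 *+ 8 + W ^+ 2 * v *+ 2 + v ^+ 2 *+ 2 + z \in S.
  by rewrite !(rpredD, rpredM, rpredMn, rpredX).
by have := GD (GX8 uS) (G_2 rS); congr G; rewrite /W; ring.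
Qed.

Lemma sum8_mx22 (M : 'M[R]_2) : M \is a mxOver S -> sum_of_powers 8 S M.
Proof.
move=> /mxOverP MS; rewrite [M]mx22E.
have tS : M 0 0 + M 1 1 \in S by rewrite rpredD.
by apply: sum8_trace (trace8_all tS); rewrite ?addr0 ?rpred0.
Qed.

End TwoByTwo.

(** * From 2 by 2 to n by n matrices *)

Lemma sum8_mx (R : comNzRingType) (S : subringClosed R) n (M : 'M[R]_n) :
  square_mod2 S -> (2 <= n)%N -> M \is a mxOver S -> sum_of_powers 8 S M.
Proof.
move=> Ssqr n2 /mxOverP MS.
rewrite [M]matrix_sum_delta; apply: sum_of_powers_sum => // i _.
apply: sum_of_powers_sum => // j _.
(* Each entry is placed in a 2 by 2 block on two distinct indices including [i] and [j]; if [i = j],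
   the other index is 1 or 0. *)
have [f f_inj [k [l [fk fl]]]] :
  exists2 f : 'I_2 -> 'I_n, injective f & exists k l, f k = i /\ f l = j.
  have two (i' j' : 'I_n) : i' != j' ->
      injective (fun k : 'I_2 => if k == 0 then i' else j').
    move=> ij [[|[|//]] a] [[|[|//]] b] //= E; apply: val_inj => //=;
    by rewrite E eqxx in ij.
  have [ij|ij] := eqVneq i j; last first.
    by exists (fun k => if k == 0 then i else j); [apply: two | exists 0, 1].
  have [k ik] : exists k : 'I_n, i != k.
    have [i0|i0] := posnP i.
      by exists (Ordinal n2); rewrite -val_eqE /= i0.
    by exists (Ordinal (ltnW n2)); rewrite -val_eqE /= -lt0n.
  exists (fun l => if l == 0 then i else k); first exact: two.
  by exists 0, 0.
pose P : 'M[R]_(2, n) := \matrix_(a, b) (b == f a)%:R.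
have PP : P *m P^T = 1%:M.
  apply/matrixP=> a b; rewrite !mxE (bigD1 (f a)) //= !mxE eqxx mul1r big1.
    by rewrite addr0 (inj_eq f_inj).
  by move=> c /negPf ca; rewrite mxE ca mul0r.
have PS : P \is a mxOver S by apply/mxOverP=> a b; rewrite mxE rpred_nat.
have -> : M i j *: delta_mx i j = P^T *m (M i j *: delta_mx k l) *m P.
  rewrite -scalemxAr -scalemxAl; congr (_ *: _).
  apply/matrixP=> a b; rewrite !mxE (bigD1 l) //= !mxE (bigD1 k) //= !mxE !eqxx.
  rewrite !big1 ?addr0.
  - by rewrite mulr1 -natrM mulnb fk fl.
  - move=> c /negPf cl; rewrite !mxE big1 ?mul0r // => d _.
    by rewrite !mxE cl andbF mulr0.
  - by move=> c /negPf ck; rewrite !mxE ck mulr0.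
apply: sum_of_powers_embed => //; apply: sum8_mx22 => //.
by apply: mxOverZ => //; apply/mxOverP=> a b; rewrite mxE rpred_nat.
Qed.

(** * Traces of squares modulo 2 *)

Lemma mxtrace_sqr (R : comPzRingType) n (A : 'M[R]_n) :
  \tr (A *m A) = (\tr A) ^+ 2 +
    (\sum_(i < n) \sum_(j < n | (i < j)%N) (A i j * A j i - A i i * A j j)) *+ 2.
Proof.
pose F i j := A i j * A j i - A i i * A j j.
(* [F] is symmetric and vanishes on the diagonal, so each pair [i < j] counts twice. *)
suff FE : \sum_i \sum_j F i j =
    (\sum_(i < n) \sum_(j < n | (i < j)%N) F i j) *+ 2.
  rewrite -FE addrC; apply/eqP; rewrite -subr_eq; apply/eqP.
  rewrite /mxtrace expr2 mulr_suml -sumrB; apply: eq_bigr => i _.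
  by rewrite mxE mulr_sumr -sumrB.
have split3 i : \sum_j F i j =
    \sum_(j < n | (i < j)%N) F i j + \sum_(j < n | (j < i)%N) F i j.
  rewrite (bigID (fun j : 'I_n => (i < j)%N)) /=; congr (_ + _).
  rewrite (bigD1 i) ?ltnn //= {1}/F subrr add0r; apply: eq_bigl => j.
  by rewrite -leqNgt ltn_neqAle andbC.
under eq_bigr => i _ do rewrite split3.
rewrite big_split mulr2n /=; congr (_ + _).
rewrite (exchange_big_dep predT) //=; apply: eq_bigr => i _.
by apply: eq_bigr => j _; rewrite /F mulrC [A i i * _]mulrC.
Qed.

Lemma mxtrace_sqr_mod2 (R : comPzRingType) (S : subringClosed R) n
    (A : 'M[R]_n) :
  A \is a mxOver S -> exists2 z, z \in S & \tr (A *m A) = (\tr A) ^+ 2 + z *+ 2.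
Proof.
move=> /mxOverP AS; eexists; last exact: mxtrace_sqr.
by apply: rpred_sum => i _; apply: rpred_sum => j _; rewrite rpredB ?rpredM.
Qed.

Lemma square_mod2_of_sum8 (R : comNzRingType) (S : subringClosed R) n :
  (forall M : 'M[R]_n.+1, M \is a mxOver S -> sum_of_powers 8 S M) ->
  square_mod2 S.
Proof.
move=> sums x xS.
have MS : x *: delta_mx 0 0 \is a @mxOver n.+1 n.+1 _ S.
  by apply: mxOverZ => //; apply/mxOverP=> a b; rewrite mxE rpred_nat.
have trM : \tr (x *: delta_mx 0 0 : 'M_n.+1) = x.
  rewrite mxtraceZ /mxtrace (bigD1 0) //= mxE !eqxx big1 ?addr0 ?mulr1 //.
  by move=> i /negPf i0; rewrite mxE i0.
have [r [Ms [_ MsS ME]]] := sums _ MS; rewrite -{}trM {}ME raddf_sum /=.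
elim: r Ms MsS => [|r IHr] Ms MsS.
  by exists 0, 0; rewrite big_ord0 !rpred0 expr0n mul0rn addr0.
rewrite big_ord_recl.
have [y [z [yS zS ->]]] := IHr (fun i => Ms (lift ord0 i)) (fun i => MsS _).
have AS : Ms ord0 ^+ 4 \is a mxOver S.
  by rewrite (exprM _ 2 2) !expr2 -!mulmxE !mxOverM.
have [w wS] := mxtrace_sqr_mod2 AS; rewrite mulmxE -expr2 -exprM => ->.
have tS : \tr (Ms ord0 ^+ 4) \in S by apply: rpred_sum => i _; apply/mxOverP.
(* With [t] the trace of the fourth power, [t^2 + y^2 = (t + y)^2 - 2 t y]. *)
exists (\tr (Ms ord0 ^+ 4) + y), (w + z - \tr (Ms ord0 ^+ 4) * y).
by rewrite !(rpredD, rpredN, rpredM) //; split=> //; ring.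
Qed.

(** * Commutative algebras given by multiplication tables *)

Section MultTable.
Variables (R : comNzRingType) (m : nat).
Implicit Types (B : 'I_m -> 'M[R]_m) (u v w : 'rV[R]_m).

(* [B i] is the matrix, acting on row vectors, of multiplication by the [i]-th
   basis vector of a commutative algebra whose unit has coordinates [u]. *)
Definition mult_table B u : Prop :=
  [/\ forall i j, B i *m B j = \sum_k B j i k *: B k,
      forall i j, row i (B j) = row j (B i)
    & \sum_i u 0 i *: B i = 1%:M].

(** Multiplication by the element with coordinates [v]; thus [v *m elem_mx B w] is the coordinate
    vector of a product. *)
Definition elem_mx B v : 'M[R]_m := \sum_i v 0 i *: B i.

Definition trace_form B : 'M[R]_m := \matrix_(i, j) \tr (B i *m B j).

Lemma elem_mxB B v w : elem_mx B (v - w) = elem_mx B v - elem_mx B w.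
Proof.
by rewrite /elem_mx -sumrB; apply: eq_bigr => i _; rewrite !mxE scalerBl.
Qed.

Lemma elem_mx_delta B i : elem_mx B (delta_mx 0 i) = B i.
Proof.
rewrite /elem_mx (bigD1 i) //= mxE !eqxx scale1r big1 ?addr0 // => j /negPf ji.
by rewrite mxE ji andbF scale0r.
Qed.

Lemma trace_formE B v w :
  v *m trace_form B *m w^T = (\tr (elem_mx B v *m elem_mx B w))%:M.
Proof.
apply/matrixP=> i0 j0; rewrite !ord1 [RHS]mxE eqxx mulr1n.
rewrite {1}/elem_mx mulmx_suml raddf_sum /= [LHS]mxE.
under [LHS]eq_bigr => j _ do rewrite mxE mulr_suml.
rewrite exchange_big /=; apply: eq_bigr => i _.
rewrite /elem_mx mulmx_sumr raddf_sum; apply: eq_bigr => j _ /=.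
by rewrite !mxE -scalemxAl -scalemxAr !mxtraceZ mulrAC mulrA.
Qed.

Variables (B : 'I_m -> 'M[R]_m) (u : 'rV[R]_m).
Hypothesis Bu : mult_table B u.

Lemma mul_elem_mxC v w : v *m elem_mx B w = w *m elem_mx B v.
Proof.
have [_ BC _] := Bu.
have E v' w' : v' *m elem_mx B w' =
    \sum_i \sum_j (v' 0 i * w' 0 j) *: row i (B j).
  rewrite mulmx_sum_row; apply: eq_bigr => i _; rewrite /elem_mx.
  rewrite linear_sum scaler_sumr; apply: eq_bigr => j _.
  by rewrite linearZ scalerA.
rewrite !E exchange_big; apply: eq_bigr => i _; apply: eq_bigr => j _.
by rewrite BC mulrC.
Qed.

Lemma elem_mxM v w : elem_mx B (v *m elem_mx B w) = elem_mx B v *m elem_mx B w.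
Proof.
have [BM _ _] := Bu; rewrite {3 4}/elem_mx mulmx_suml.
under [RHS]eq_bigr => i _ do rewrite mulmx_sumr.
transitivity (\sum_i \sum_j \sum_k (v 0 i * (w 0 j * B j i k)) *: B k).
  rewrite /elem_mx; under eq_bigr => k _ do rewrite mxE scaler_suml.
  rewrite exchange_big; apply: eq_bigr => i _.
  rewrite exchange_big; apply: eq_bigr => k _ /=.
  rewrite summxE mulr_sumr scaler_suml; apply: eq_bigr => j _.
  by rewrite mxE.
apply: eq_bigr => i _; apply: eq_bigr => j _.
rewrite -scalemxAl -scalemxAr BM scalerA scaler_sumr; apply: eq_bigr => k _.
by rewrite scalerA mulrA.
Qed.

Lemma elem_mx_comm v w :
  elem_mx B v *m elem_mx B w = elem_mx B w *m elem_mx B v.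
Proof. by rewrite -!elem_mxM mul_elem_mxC. Qed.

Lemma mul_unit_elem_mx v : u *m elem_mx B v = v.
Proof.
by have [_ _ B1] := Bu; rewrite mul_elem_mxC /elem_mx B1 mulmx1.
Qed.

Definition sqr_elem v := v *m elem_mx B v.

Lemma elem_mx_sqr v : elem_mx B (sqr_elem v) = elem_mx B v ^+ 2.
Proof. by rewrite elem_mxM expr2. Qed.

Lemma elem_mx_iter k v :
  elem_mx B (iter k sqr_elem v) = elem_mx B v ^+ (2 ^ k).
Proof.
elim: k => [|k IHk]; first by rewrite expr1.
by rewrite iterS elem_mx_sqr IHk -exprM expnS mulnC.
Qed.

Lemma sqr_elemB v w : 2 \in [pchar R] ->
  sqr_elem (v - w) = sqr_elem v - sqr_elem w.
Proof.
move=> R2; have N2 (x : 'rV[R]_m) : x + x = 0.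
  by apply/matrixP=> i j; rewrite !mxE addrr_pchar2.
rewrite /sqr_elem elem_mxB mulmxBr !mulmxBl (mul_elem_mxC w v) opprB addrACA.
by rewrite -opprD N2 subr0 (addr0_eq (N2 _)).
Qed.

End MultTable.

Lemma mult_table_map (R R' : comNzRingType) (f : {rmorphism R -> R'}) m
    (B : 'I_m -> 'M[R]_m) u :
  mult_table B u -> mult_table (fun i => map_mx f (B i)) (map_mx f u).
Proof.
have mapE (c : 'I_m -> R) : map_mx f (\sum_i c i *: B i) =
    \sum_i f (c i) *: map_mx f (B i).
  by rewrite raddf_sum; apply: eq_bigr => i _; rewrite /= map_mxZ.
move=> [BM BC B1]; split=> [i j|i j|].
- by rewrite -map_mxM BM mapE; apply: eq_bigr => k _; rewrite mxE.
- by rewrite -!map_row BC.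
have := congr1 (map_mx f) B1; rewrite mapE map_mx1 => <-.
by apply: eq_bigr => i _; rewrite mxE.
Qed.

Lemma map_elem_mx (R R' : comNzRingType) (f : {rmorphism R -> R'}) m
    (B : 'I_m -> 'M[R]_m) v :
  map_mx f (elem_mx B v) = elem_mx (fun i => map_mx f (B i)) (map_mx f v).
Proof.
by rewrite raddf_sum; apply: eq_bigr => i _; rewrite /= map_mxZ mxE.
Qed.

Lemma map_sqr_elem (R R' : comNzRingType) (f : {rmorphism R -> R'}) m
    (B : 'I_m -> 'M[R]_m) v :
  map_mx f (sqr_elem B v) = sqr_elem (fun i => map_mx f (B i)) (map_mx f v).
Proof. by rewrite map_mxM map_elem_mx. Qed.

Lemma map_trace_form (R R' : comNzRingType) (f : {rmorphism R -> R'}) m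
    (B : 'I_m -> 'M[R]_m) :
  map_mx f (trace_form B) = trace_form (fun i => map_mx f (B i)).
Proof.
by apply/matrixP=> i j; rewrite !mxE -map_mxM trace_map_mx.
Qed.

(** * Frobenius and trace form in characteristic 2 *)

Lemma mxtrace_sqr_pchar2 (F : fieldType) n (A : 'M[F]_n) :
  2 \in [pchar F] -> \tr (A *m A) = (\tr A) ^+ 2.
Proof.
by move=> F2; rewrite mxtrace_sqr -mulr_natr (pcharf0 F2) mulr0 addr0.
Qed.

(* [x ^+ 2 = 0] makes [\tr (x y) ^+ 2 = \tr (x ^+ 2 y ^+ 2)] vanish for all [y],
   so squaring is injective as soon as the trace form is nondegenerate. *)
Lemma sqr_elem_surj (F : finFieldType) m (B : 'I_m -> 'M[F]_m) u :
  2 \in [pchar F] -> mult_table B u -> \det (trace_form B) != 0 ->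
  forall w, exists v, w = sqr_elem B v.
Proof.
move=> F2 Bu detB w.
suff sq_inj : injective (sqr_elem B) by exists (invF sq_inj w); rewrite f_invF.
move=> v v' /eqP; rewrite -subr_eq0 -(sqr_elemB Bu) // => /eqP sq0.
apply/eqP; rewrite -subr_eq0; move: (v - v') sq0 => {v v'} x sq0.
have TU : trace_form B \in unitmx by rewrite unitmxE unitfE.
rewrite -(mulmxK TU x); suff -> : x *m trace_form B = 0 by rewrite mul0mx.
apply/matrixP=> i j; rewrite mxE !ord1 {i}.
pose y : 'rV[F]_m := delta_mx 0 j.
have /(congr1 (fun A : 'M_1 => A 0 0)) := trace_formE B x y.
have -> : x *m trace_form B *m y^T = col j (x *m trace_form B).
  by rewrite trmx_delta -colE.
rewrite !mxE eqxx mulr1n => ->; apply/eqP; rewrite -sqrf_eq0.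
rewrite -mxtrace_sqr_pchar2 // mulmxA -(mulmxA (elem_mx B x)).
rewrite (elem_mx_comm Bu y x) mulmxA -(elem_mxM Bu x) -/(sqr_elem B x) sq0.
rewrite -[elem_mx B 0]/(\sum_i _) big1 ?mul0mx ?mxtrace0 // => i _.
by rewrite mxE scale0r.
Qed.

(** Equality over any ring of characteristic 2 is congruence modulo 2, so identities pass from
    ['F_2] to larger fields. *)
Lemma int_mx_mod2 (R R' : nzRingType) m n (A A' : 'M[int]_(m, n)) :
  2 \in [pchar R] -> 2 \in [pchar R'] ->
  map_mx (intr : int -> R) A = map_mx intr A' ->
  map_mx (intr : int -> R') A = map_mx intr A'.
Proof.
move=> R2 R'2 /matrixP E; apply/matrixP=> i j; move: (E i j); rewrite !mxE.
move/eqP; rewrite -subr_eq0 -intrB -(dvdz_pcharf R2) (dvdz_pcharf R'2) intrB.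
by rewrite subr_eq0 => /eqP.
Qed.

(** [A] is a root of [X^q - X], with [q = #|F|], which is the product of the distinct factors
    [X - a] for [a] in [F]. *)
Lemma diagonalizable_expf_card (F : finFieldType) m (A : 'M[F]_m.+1) :
  A ^+ #|F| = A -> mxpoly.diagonalizable A.
Proof.
move=> AF; apply/diagonalizableP; exists (enum F); first exact: enum_uniq.
rewrite big_enum -finField_genPoly; apply: mxminpoly_min.
by rewrite rmorphB rmorphXn /= horner_mx_X AF subrr.
Qed.

(* Diagonalizing the table simultaneously, [\sum_k d i k * d j k] is the entry
   [(i, j)] of the trace form, and [d] is invertible since the table is free. *)
Lemma trace_form_unit (F : finFieldType) m (B : 'I_m -> 'M[F]_m) u :
  mult_table B u -> (forall i, B i ^+ #|F| = B i) -> \det (trace_form B) != 0.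
Proof.
case: m B u => [|m] B u Bu BF; first by rewrite det_mx00 oner_neq0.
have BC i j : B i *m B j = B j *m B i.
  by rewrite -!(elem_mx_delta B) (elem_mx_comm Bu).
have [P Punit /allP PB] : mxpoly.codiagonalizable [seq B i | i <- enum 'I_m.+1].
  apply/mxpoly.codiagonalizableP; split.
    by move=> _ _ /mapP[i _ ->] /mapP[j _ ->]; apply: BC.
  by move=> _ /mapP[i _ ->]; apply: diagonalizable_expf_card.
have {PB} dP i : exists d, B i = invmx P *m diag_mx d *m P.
  have /PB/mxpoly.diagonalizable_forPex[d /(mxpoly.simmxLR Punit) ->] :
    B i \in [seq B i | i <- enum 'I_m.+1] by rewrite map_f ?mem_enum.
  by exists d; rewrite mxpoly.conjVmx.
have [d dE] := fin_all_exists dP.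
pose D := \matrix_i d i.
have -> : trace_form B = D *m D^T.
  apply/matrixP=> i j; rewrite !mxE !dE !mulmxA mulmxK // -!mulmxA mxtrace_mulC.
  rewrite -!mulmxA mulmxV // mulmx1 mulmx_diag mxtrace_diag.
  by apply: eq_bigr => k _; rewrite !mxE.
rewrite det_mulmx det_tr -expr2 expf_neq0 // -unitfE -unitmxE -row_free_unit.
(* If [c *m D = 0], the element with coordinates [c] acts as zero, and its product with the unit
   recovers [c]. *)
apply/inj_row_free => c cD0; rewrite -(mul_unit_elem_mx Bu c).
suff -> : elem_mx B c = invmx P *m diag_mx (c *m D) *m P.
  by rewrite cD0 linear0 mulmx0 mul0mx mulmx0.
rewrite mulmx_sum_row linear_sum mulmx_sumr mulmx_suml; apply: eq_bigr => i _.
by rewrite rowK linearZ -scalemxAr -scalemxAl -dE.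
Qed.

Lemma odd_disc_of_sqr_surj m (B : 'I_m -> 'M[int]_m) u :
  let B2 i := map_mx (intr : int -> 'F_2) (B i) in
  mult_table B u -> (forall w, exists v, w = sqr_elem B2 v) ->
  ~~ (2 %| \det (trace_form B))%Z.
Proof.
move=> B2 Bu surj.
have Bu2 : mult_table B2 (map_mx intr u) := mult_table_map _ Bu.
have sq_inj : injective (sqr_elem B2).
  have [g gK] := fin_all_exists surj; apply: bij_inj.
  have gK' : cancel g (sqr_elem B2) by move=> w; rewrite -gK.
  by move/bij_can_bij: (injF_bij (can_inj gK')); apply.
(* Squaring permutes a finite set; if [k] is the order of this permutation, then [x^(2^k) = x]. *)
pose s := perm sq_inj; pose k := #[s]%g.
have B2k i : B2 i ^+ (2 ^ k) = B2 i.
  rewrite -(elem_mx_delta B2 i) -(elem_mx_iter Bu2); congr elem_mx.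
  by rewrite -(eq_iter (permE sq_inj)) -permX expg_order perm1.
(* A field with [2^k] elements turns this exponent into [#|F|]; parity of the determinant can be
   tested in it. *)
have [F F2 cardF] := pPrimePowerField (isT : prime 2) (order_gt0 s).
rewrite (dvdz_pcharf F2) -det_map_mx map_trace_form.
apply: trace_form_unit (mult_table_map _ Bu) _ => i; rewrite cardF.
have BE (R : comNzRingType) j :
    map_mx (intr : int -> R) (B i ^+ j) = map_mx intr (B i) ^+ j.
  elim: j => [|j IHj]; first by rewrite !expr0 map_mx1.
  by rewrite !exprS map_mxM IHj.
by rewrite -BE; apply: (int_mx_mod2 (pchar_Fp _) F2); rewrite // BE B2k.
Qed.

Lemma int_mx_lift m n (A : 'M['F_2]_(m, n)) :
  exists A' : 'M[int]_(m, n), A = map_mx intr A'.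
Proof.
exists (\matrix_(i, j) (A i j : nat)%:Z); apply/matrixP=> i j.
by rewrite !mxE -pmulrn natr_Zp.
Qed.

Lemma int_mx_mod2P m n (A A' : 'M[int]_(m, n)) :
  map_mx (intr : int -> 'F_2) A = map_mx intr A' ->
  exists C, A = A' + C *+ 2.
Proof.
move=> /matrixP E; exists (\matrix_(i, j) ((A i j - A' i j) %/ 2)%Z).
apply/matrixP=> i j; have /eqP := E i j; rewrite !mxE -subr_eq0 -intrB.
rewrite -(dvdz_pcharf (pchar_Fp _)) // => dvd2.
have E2 : ((A i j - A' i j) %/ 2)%Z * 2%:R = A i j - A' i j := divzK dvd2.
move: E2; set q := (_ %/ _)%Z; rewrite mulr_natr mulr2n => ->.
by rewrite addrC subrK.
Qed.

(** * Coordinates in an order *)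

Section Order.
Variables (K : fieldExtType rat) (O : nf_order K) (b : (\dim {:K}).-tuple K).
Hypothesis bO : Zbasis O b.
Local Notation m := (\dim {:K}).

Definition of_coords (v : 'rV[int]_m) : K := \sum_(i < m) b`_i *~ v 0 i.

(** Meaningful on [O] only: there the rational coordinates are integers and [numq] loses nothing. *)
Definition coords (x : K) : 'rV[int]_m := \row_(i < m) numq (coord b i x).

Definition order_table (i : 'I_m) : 'M[int]_m :=
  \matrix_(j < m) coords (b`_j * b`_i).

Lemma of_coords_sum (I : finType) (c : I -> int) (v : I -> 'rV[int]_m) :
  of_coords (\sum_i c i *: v i) = \sum_i of_coords (v i) *~ c i.
Proof.
transitivity (\sum_i \sum_(j < m) b`_j *~ v i 0 j *~ c i); last first.
  by apply: eq_bigr => i _; rewrite mulrz_suml.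
rewrite exchange_big; apply: eq_bigr => j _ /=; rewrite summxE mulrz_sumr.
by apply: eq_bigr => i _; rewrite mxE mulrC mulrzA.
Qed.

Lemma of_coordsD v w : of_coords (v + w) = of_coords v + of_coords w.
Proof.
by rewrite /of_coords -big_split; apply: eq_bigr => i _; rewrite mxE mulrzDr.
Qed.

Lemma of_coords_inj : injective of_coords.
Proof.
move=> v w E; apply/eqP; rewrite -subr_eq0; apply/eqP/matrixP=> i0 i.
rewrite ord1 [RHS]mxE; case: bO => _ /(_ ((v - w) 0)); apply.
have: of_coords (v - w) + of_coords w = of_coords w.
  by rewrite -of_coordsD subrK.
by move/(canRL (addrK _)); rewrite subrr.
Qed.

Lemma of_coords_mem v : of_coords v \in O.
Proof.
case: bO => OP _; apply/OP; exists [ffun i => v 0 i].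
by apply: eq_bigr => i _; rewrite ffunE.
Qed.

Lemma coordsK x : x \in O -> of_coords (coords x) = x.
Proof.
move=> xO; rewrite [RHS](coord_basis (Zbasis_basis bO) (memvf x)).
apply: eq_bigr => i _; rewrite mxE -scaler_int numqK //.
exact: (coord_Zbasis_int i bO xO).
Qed.

Lemma mul_coords_table v (i : 'I_m) :
  of_coords (v *m order_table i) = of_coords v * b`_i.
Proof.
rewrite mulmx_sum_row of_coords_sum mulr_suml; apply: eq_bigr => j _.
by rewrite rowK coordsK ?mulrzAl // rpredM ?(Zbasis_mem _ bO).
Qed.

Lemma of_coordsM v w :
  of_coords (v *m elem_mx order_table w) = of_coords v * of_coords w.
Proof.
rewrite mulmx_sumr; under eq_bigr do rewrite -scalemxAr.
rewrite of_coords_sum mulr_sumr; apply: eq_bigr => i _.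
by rewrite mul_coords_table mulrzAr.
Qed.

(** Read in [K] row by row, the axioms are associativity, commutativity and the unit law. *)
Lemma order_tableP : mult_table order_table (coords 1).
Proof.
have bmem (i : 'I_m) : b`_i \in O := Zbasis_mem _ bO.
have bM (i j : 'I_m) : b`_i * b`_j \in O by rewrite rpredM.
have O1 : 1 \in O := rpred1 _.
split=> [i j|i j|].
- apply/row_matrixP=> k; apply: of_coords_inj.
  rewrite row_mul rowK mul_coords_table coordsK // linear_sum.
  under eq_bigr => l _ do rewrite linearZ /= rowK.
  rewrite of_coords_sum; under eq_bigr => l _ do rewrite coordsK // -mulrzAr.
  rewrite -mulr_sumr -mulrA; congr (_ * _); rewrite -[LHS]coordsK //.
  by apply: eq_bigr => l _; rewrite [order_table j i l]mxE.
- by rewrite !rowK mulrC.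
apply/row_matrixP=> k; apply: of_coords_inj.
by rewrite row1 rowE of_coordsM coordsK // mulr1.
Qed.

(** In the basis [b], multiplication by the product has as matrix the integer matrix
    [order_table i *m order_table j]. *)
Lemma nf_trace_mul (i j : 'I_m) :
  nf_trace (b`_i * b`_j) = (trace_form order_table i j)%:~R.
Proof.
have bmem (k : 'I_m) : b`_k \in O := Zbasis_mem _ bO.
rewrite (nf_traceE _ (Zbasis_basis bO)) mxE /mxtrace rmorph_sum.
apply: eq_bigr => k _; transitivity (coord b k (b`_i * b`_j * b`_k)).
  by rewrite !mxE /= passmx.vecof_delta lfunE.
have /rowP/(_ k) : row k (order_table i *m order_table j) =
    coords (b`_i * b`_j * b`_k).
  apply: of_coords_inj; rewrite row_mul rowK mul_coords_table.
  by rewrite !coordsK ?rpredM // -mulrA mulrC.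
rewrite [LHS]mxE => ->.
by rewrite mxE /= numqK // (coord_Zbasis_int _ bO) // !rpredM.
Qed.

Lemma disc_trace_form : disc O = \det (trace_form order_table).
Proof.
apply: (@intr_inj rat); rewrite (discE bO) -det_map_mx; congr (\det _).
by apply/matrixP=> i j; rewrite mxE nf_trace_mul [RHS]mxE.
Qed.

Local Notation table2 :=
  (fun i => map_mx (intr : int -> 'F_2) (order_table i)).

Lemma square_mod2P :
  square_mod2 O <-> forall w, exists v, w = sqr_elem table2 v.
Proof.
split=> [Osqr w|surj x xO].
  have [w' ->] := int_mx_lift w.
  have [y [z [yO zO E]]] := Osqr _ (of_coords_mem w').
  exists (map_mx intr (coords y)); rewrite -map_sqr_elem.
  have -> : w' = sqr_elem order_table (coords y) + coords z *+ 2.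
    by apply: of_coords_inj; rewrite mulr2n !of_coordsD of_coordsM !coordsK.
  rewrite mulr2n !map_mxD -[RHS]addr0; congr (_ + _); apply/matrixP=> i j.
  by rewrite !mxE addrr_pchar2 // pchar_Fp.
have [v xv] := surj (map_mx intr (coords x)); have [v' vE] := int_mx_lift v.
move: xv; rewrite {v}vE -map_sqr_elem => /int_mx_mod2P[z xE].
exists (of_coords v'), (of_coords z); rewrite !of_coords_mem; split=> //.
by rewrite -{1}(coordsK xO) xE mulr2n !of_coordsD of_coordsM.
Qed.

Lemma square_mod2_odd_disc : square_mod2 O <-> ~~ (2 %| disc O)%Z.
Proof.
rewrite disc_trace_form; split=> [/square_mod2P|odd_disc].
  exact: odd_disc_of_sqr_surj order_tableP.
apply/square_mod2P; have F2 := pchar_Fp (isT : prime 2).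
apply: sqr_elem_surj (F2) (mult_table_map _ order_tableP) _.
by rewrite -map_trace_form det_map_mx -(dvdz_pcharf F2).
Qed.

End Order.

Theorem theorem5p3 (K : fieldExtType rat) (O : nf_order K) (n : nat)
    (n_ge2 : (2 <= n)%N) :
  (forall M : 'M[K]_n, M \is a mxOver O -> sum_of_powers 8 O M) <->
  gcdz 2 (disc O) = 1.
Proof.
have [b bO] := nf_order_free O.
have gcd_odd : gcdz 2 (disc O) = 1 <-> ~~ (2 %| disc O)%Z.
  rewrite dvdzE -prime_coprime //.
  by split=> [[/eqP]|/eqP gcd1]; last rewrite /gcdz gcd1.
rewrite gcd_odd -(square_mod2_odd_disc bO); split=> [|Osqr M MO].
  by case: n n_ge2 => // n _; apply: square_mod2_of_sum8.
exact: sum8_mx.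
Qed.
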